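(* Assume that $(W,d)$ is a Hilbert complex with domain complex $(V,d)$, finite dimensional subcomplex $(V_h,d)$, and commuting, $V$-bounded cochain operator $\pi_h:V\to V_h$, and in addition that $(\sigma,u,p)$ and $(\sigma_h,u_h,p_h)$ solve, respectively, the continuous and the discrete mixed abstract Hodge Laplace problems with data $f\in W^k$. Put $e_\sigma=\sigma-\sigma_h$, $e_u=u-u_h$, $e_p=p-p_h$. Then for some $(\tau,v,q)\in V^{k-1}\times V^k\times\mathfrak{H}^k$ with $\|\tau\|_V+\|v\|_V+\|q\|=1$ and some $\phi\in V^{k-1}$ with $\|\phi\|_V=1$, $$\begin{aligned}\|e_\sigma\|_V+\|e_u\|_V+\|e_p\|\lesssim{}&|\langle e_\sigma,\tau-\pi_h\tau\rangle-\langle d(\tau-\pi_h\tau),e_u\rangle|\\&+|\langle f-d\sigma_h-p_h,v-\pi_hv\rangle-\langle du_h,d(v-\pi_hv)\rangle|\\&+|\langle p_h,d(\phi-\pi_h\phi)\rangle|+\mu\,\|u_h^\perp-P_{\mathfrak{Z}^\perp}u_h^\perp\|.\end{aligned}$$ Here $\mu=(\sum_{i=1}^M\mu_i^2)^{1/2}$, where $$\sup_{\phi\in V^{k-1},\,\|\phi\|_V=1}\langle q_i,d(\phi-\pi_h\phi)\rangle\lesssim\mu_i,\qquad i=1,\dots,M,$$ for an orthonormal basis $\{q_1,\dots,q_M\}$ of $\mathfrak{H}_h^k$. For the last term in the error bound one may either use the simple bound $\|u_h^\perp-P_{\mathfrak{Z}^\perp}u_h^\perp\|\le\|u_h\|$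 or employ the bound $$\mu\,\|u_h^\perp-P_{\mathfrak{Z}^\perp}u_h^\perp\|\lesssim\mu\epsilon+\mu^2\|u_h\|,$$ where $$\sup_{\phi\in V^{k-1},\,\|\phi\|_V=1}\langle u_h^\perp,d(\phi-\pi_h\phi)\rangle\lesssim\epsilon.$$
   Context: A Hilbert complex $(W,d)$ is a sequence of Hilbert spaces $W^k$ (inner product $\langle\cdot,\cdot\rangle$, norm $\|\cdot\|$) with closed, densely defined linear maps $d=d^k$ from $W^k$ into $W^{k+1}$ such that the range of $d^k$ lies in the domain of $d^{k+1}$ and $d^{k+1}\circ d^k=0$. $V^k\subset W^k$ is the domain of $d^k$; the domain complex $(V,d)$ carries the inner product $\langle u,v\rangle_V=\langle u,v\rangle+\langle du,dv\rangle$ and the norm $\|\cdot\|_V$. Throughout, $(W,d)$ is assumed to satisfy the compactness property: for each $k$, $V^k\cap V_k^*$ is dense in $W^k$ with compact inclusion, where $V_k^*\subset W^k$ is the domain of the adjoint $d_k^*$ of $d^{k-1}$. $\mathfrak{Z}^k$ is the kernel of $d^k$, $\mathfrak{B}^k$ is the range of $d^{k-1}$, $\mathfrak{H}^k=\{\omega\in\mathfrak{Z}^k:\omega\perp\mathfrak{B}^k\}$ is the space of harmonic forms, and $\mathfrak{Z}^{k\perp}$ is the orthogonal complement of $\mathfrak{Z}^k$ in $V^k$, so that $V^k=\mathfrak{B}^k\oplus\mathfrak{H}^k\oplus\mathfrak{Z}^{k\perp}$. The Poincaré inequality $\|v\|_V\lesssim\|dv\|$ holds for $v\in\mathfrak{Z}^{k\perp}$.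 $V_h^k\subset V^k$ are finite dimensional subspaces with $dV_h^k\subset V_h^{k+1}$, so $(V_h,d)$ is a subcomplex of $(V,d)$. $\mathfrak{Z}_h^k$ is the kernel of $d$ on $V_h^k$, $\mathfrak{B}_h^k=dV_h^{k-1}$, $\mathfrak{H}_h^k=\{\omega\in\mathfrak{Z}_h^k:\omega\perp\mathfrak{B}_h^k\}$, and $\mathfrak{Z}_h^{k\perp}$ is the orthogonal complement of $\mathfrak{Z}_h^k$ in $V_h^k$, giving the discrete Hodge decomposition $V_h^k=\mathfrak{B}_h^k\oplus\mathfrak{H}_h^k\oplus\mathfrak{Z}_h^{k\perp}$. The operator $\pi_h=\pi_h^k:V^k\to V_h^k$ commutes with the differential, $d^k\circ\pi_h^k=\pi_h^{k+1}\circ d^k$; it is not required to be a projection. Continuous problem: $(\sigma,u,p)\in V^{k-1}\times V^k\times\mathfrak{H}^k$ satisfies $\langle\sigma,\tau\rangle-\langle d\tau,u\rangle=0$ for all $\tau\in V^{k-1}$; $\langle d\sigma,v\rangle+\langle du,dv\rangle+\langle v,p\rangle=\langle f,v\rangle$ for all $v\in V^k$; $\langle u,q\rangle=0$ for all $q\in\mathfrak{H}^k$. Discrete problem: $(\sigma_h,u_h,p_h)\in V_h^{k-1}\times V_h^k\times\mathfrak{H}_h^k$ satisfies the same three equations with test functions ranging over $V_h^{k-1}$, $V_h^k$, $\mathfrak{H}_h^k$ respectively. $u_h^\perp$ is the component of $u_h$ in $\mathfrak{Z}_h^{k\perp}$ in the discrete Hodge decomposition, and $P_{\mathfrak{Z}^\perp}$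 is the orthogonal projection onto $\mathfrak{Z}^{k\perp}$. The notation $a\lesssim b$ means $a\le Cb$ with a constant $C$ that does not depend on essential quantities.
   Formalization: Adds the hypothesis that the dimension of the harmonic space H^k is at most that of the discrete space H_h^k (the bound fails without it), and requires the normalizations of φ and (τ,v,q) only when V^{k-1}, respectively V^{k-1} or V^k, is nonzero. *)

(* Defs.v *)
From HB Require Import structures.
From mathcomp Require Import all_boot all_order all_algebra.
From mathcomp Require Import sesquilinear.
From mathcomp Require Import all_classical all_reals all_analysis.
Set Implicit Arguments.
Unset Strict Implicit.
Unset Printing Implicit Defensive.
Import Order.TTheory GRing.Theory Num.Theory.
Import numFieldNormedType.Exports.
Local Open Scope classical_set_scope.
Local Open Scope ring_scope.

(* All Hilbert spaces are real. *)

Record hilbertSpace (R : realType) := HilbertSpace {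
  carrier :> completeNormedModType R;
  inner : {dot carrier for idfun};
  inner_norm : forall u : carrier, inner u u = `|u| ^+ 2 }.

Definition dot (R : realType) (H : hilbertSpace R) (u v : H) : R :=
  inner H u v.

Definition span_of (R : realType) (H : hilbertSpace R) (n : nat)
    (b : 'I_n -> H) : set H :=
  [set x | exists a : 'I_n -> R, x = \sum_i a i *: b i].

Definition orthonormal_family (R : realType) (H : hilbertSpace R) (n : nat)
    (b : 'I_n -> H) : Prop :=
  forall i l, dot (b i) (b l) = (i == l)%:R.

Definition nontrivial (R : realType) (H : hilbertSpace R) (X : set H) : Prop :=
  exists2 x, X x & x != 0.

Definition orth_proj (R : realType) (H : hilbertSpace R) (Y : set H)
    (x y : H) : Prop :=
  Y y /\ forall z, Y z -> dot (x - y) z = 0.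

(* The unbounded operator d^k is a total function whose values outside its
   domain [V k] carry no information.  Degrees range over all integers; a
   complex with finitely many terms is extended by zero spaces. *)
Record hilbertComplex (R : realType) := HilbertComplex {
  W : int -> hilbertSpace R;
  V : forall k, set (W k);
  d : forall k, W k -> W (k + 1);
  V0 : forall k, V (0 : W k);
  V_lin : forall k (a : R) (u v : W k), V u -> V v -> V (a *: u + v);
  d_lin : forall k (a : R) (u v : W k), V u -> V v ->
    d (a *: u + v) = a *: d u + d v;
  V_dense : forall k, dense (@V k);
  d_closed : forall k,
    closed [set x : W k * W (k + 1) | V x.1 /\ x.2 = d x.1];
  d_dom : forall k (u : W k), V u -> V (d u);
  dd0 : forall k (u : W k), V u -> d (d u) = 0 }.

Arguments W {R} h k.
Arguments V {R} h k.
Arguments d {R} h {k}.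

Section Complex.
Variables (R : realType) (C : hilbertComplex R).

Definition dotV (k : int) (u v : W C k) : R := dot u v + dot (d C u) (d C v).
Definition normV (k : int) (u : W C k) : R := Num.sqrt (dotV u u).

(* [w] lies in the domain of the adjoint of d^k and is mapped by it to [z];
   [z] is unique because [V C k] is dense. *)
Definition adjoint_graph (k : int) (w : W C (k + 1)) (z : W C k) : Prop :=
  forall u, V C k u -> dot (d C u) w = dot u z.

Definition compactness_property : Prop := forall k : int,
  dense [set w | V C (k + 1) w /\ exists z, adjoint_graph w z] /\
  forall r : R, precompact [set w | V C (k + 1) w /\
    exists2 z, adjoint_graph w z &
      `|w| ^+ 2 + `|d C w| ^+ 2 + `|z| ^+ 2 <= r].

(* The following notions are taken relative to a family of subspaces [X k] of
   [V C k] stable under d: the domain complex itself, or the discrete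
   subcomplex. *)
Section Relative.
Variable X : forall k, set (W C k).

Definition cocycles (k : int) : set (W C k) := [set v | X v /\ d C v = 0].

(* Degree shift: [coboundaries k] and [harmonics k] live in degree k + 1. *)
Definition coboundaries (k : int) : set (W C (k + 1)) :=
  [set d C u | u in @X k].

Definition harmonics (k : int) : set (W C (k + 1)) :=
  [set w | cocycles w /\ forall b, coboundaries b -> dot w b = 0].

(* For v in [V C k] and a cocycle z, dot v z = dotV v z, so this is the
   orthogonal complement for both inner products. *)
Definition cocycles_perp (k : int) : set (W C k) :=
  [set v | X v /\ forall z, cocycles z -> dot v z = 0].

(* The mixed Hodge Laplace problem in degree k + 1. *)
Definition hodge_laplace (k : int) (f : W C (k + 1))
    (s : W C k) (u p : W C (k + 1)) : Prop :=
  [/\ [/\ X s, X u & harmonics p],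
      forall t, X t -> dot s t - dot (d C t) u = 0,
      forall v, X v ->
        dot (d C s) v + dot (d C u) (d C v) + dot v p = dot f v
    & forall q, harmonics q -> dot u q = 0].

End Relative.

Record subcomplex := Subcomplex {
  Vh : forall k, set (W C k);
  Vh_sub : forall k, @Vh k `<=` V C k;
  Vh_fin : forall k, exists n (b : 'I_n -> W C k), @Vh k = span_of b;
  Vh_d : forall k (u : W C k), Vh u -> Vh (d C u) }.

(* As for d, the values of [pih k] outside [V C k] carry no information. *)
Definition bounded_cochain_operator (S : subcomplex) (Cpi : int -> R)
    (pih : forall k, W C k -> W C k) : Prop :=
  forall k : int,
  [/\ forall u, V C k u -> Vh S (pih k u),
      forall (a : R) u v, V C k u -> V C k v ->
        pih k (a *: u + v) = a *: pih k u + pih k v,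
      forall u, V C k u -> d C (pih k u) = pih (k + 1) (d C u)
    & forall u, V C k u -> normV (pih k u) <= Cpi k * normV u].

(* The supremum over the V-unit sphere of <w, d(phi - pih phi)>.  The set is
   bounded above when pih is V-bounded, so [sup] is its least upper bound,
   except that it is 0 when [V C k] is the zero space. *)
Definition defect (pih : forall k, W C k -> W C k) (k : int)
    (w : W C (k + 1)) : R :=
  sup [set dot w (d C (phi - pih k phi)) |
        phi in [set phi | V C k phi /\ normV phi = 1]].

End Complex.

Arguments cocycles {R C} X k _.
Arguments coboundaries {R C} X k _.
Arguments harmonics {R C} X k _.
Arguments cocycles_perp {R C} X k _.
Arguments Vh {R C} s k _.
Arguments defect {R C} pih {k} w.

(* Main.v *)
Require Import Defs.
From mathcomp Require Import all_boot all_order all_algebra.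
From mathcomp Require Import sesquilinear.
From mathcomp Require Import all_classical all_reals all_analysis.
From mathcomp Require Import ring lra.
Import Order.TTheory GRing.Theory Num.Theory.
Import numFieldNormedType.Exports.
Set Implicit Arguments.
Unset Strict Implicit.
Unset Printing Implicit Defensive.
Local Open Scope classical_set_scope.
Local Open Scope ring_scope.

(* By Galerkin orthogonality the residual functionals vanish on the discrete
   spaces, so the terms of the bound are the values at t and v of
     A(t) = <e_s, t> - <dt, e_u>,  B(v) = <d e_s, v> + <d e_u, dv> + <v, e_p>.
   Write e_u = w + d rho + eta and p_h = dx + theta by the Hodge decomposition,
   with w orthogonal to the cocycles and eta, theta harmonic.  Testing A with
   e_s and rho, and B with d e_s, w and p - theta, controls every part of the
   error except eta and dx.  Since <p_h, dx> = |dx|^2, dx is controlled by the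
   third term of the bound.
   Finally |eta|^2 = -<u_h, eta> = -<u_h^perp - P u_h^perp, eta - eta_h> for any
   discrete harmonic eta_h, so eta is controlled by the distance from eta to
   the discrete harmonic space.  For orthonormal bases q of the discrete and r
   of the continuous harmonic space, the squared distances of the r_l to
   span q and of the q_i to span r sum to N - sum <q_i, r_l>^2 and
   M - sum <q_i, r_l>^2; as N <= M, the first sum is at most the second, which
   is O(mu^2). *)

(** * Hilbert spaces *)

Lemma harm_lt (R : realType) (e : R) : 0 < e ->
  exists N, forall n, (N <= n)%N -> n.+1%:R^-1 < e.
Proof.
move=> e0; have [N _ Ne] := near_infty_natSinv_lt (PosNum e0).
by exists N => n; exact: Ne.
Qed.

Section HilbertSpace.
Variables (R : realType) (H : hilbertSpace R).
Implicit Types (x y z : H) (a : R) (Y : set H).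

Lemma dotC x y : dot x y = dot y x.
Proof. by rewrite /dot hermC expr0 mul1r. Qed.

Lemma dotDl x y z : dot (x + y) z = dot x z + dot y z.
Proof. exact: linearDl. Qed.

Lemma dotDr x y z : dot x (y + z) = dot x y + dot x z.
Proof. exact: linearDr. Qed.

Lemma dotBl x y z : dot (x - y) z = dot x z - dot y z.
Proof. exact: linearBl. Qed.

Lemma dotBr x y z : dot x (y - z) = dot x y - dot x z.
Proof. exact: linearBr. Qed.

Lemma dotZl a x y : dot (a *: x) y = a * dot x y.
Proof. exact: linearZl_LR. Qed.

Lemma dotZr a x y : dot x (a *: y) = a * dot x y.
Proof. by rewrite dotC dotZl dotC. Qed.

Lemma dot0l x : dot 0 x = 0.
Proof. exact: linear0l. Qed.

Lemma dot0r x : dot x 0 = 0.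
Proof. exact: linear0r. Qed.

Lemma dot_suml n (b : 'I_n -> H) y :
  dot (\sum_i b i) y = \sum_i dot (b i) y.
Proof. exact: linear_sumlz. Qed.

Lemma dot_sumr n (b : 'I_n -> H) y :
  dot y (\sum_i b i) = \sum_i dot y (b i).
Proof. exact: linear_sumr. Qed.

Lemma dotxx x : dot x x = `|x| ^+ 2.
Proof. exact: inner_norm. Qed.

Lemma dotxx_eq0 x : dot x x = 0 -> x = 0.
Proof. by rewrite dotxx => /eqP; rewrite sqrf_eq0 normr_eq0 => /eqP. Qed.

Lemma dot_le x y : dot x y <= `|x| * `|y|.
Proof.
have := ler_normD x y; rewrite -(ler_pXn2r (n := 2)) ?nnegrE ?addr_ge0 //.
rewrite -dotxx dotDl !dotDr !dotxx (dotC y x); lra.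
Qed.

Lemma dot_abs_le x y : `|dot x y| <= `|x| * `|y|.
Proof.
rewrite ler_norml dot_le andbT; have := dot_le (- x) y.
by rewrite normrN -{1}scaleN1r dotZl; lra.
Qed.

Lemma normD_sqr x y :
  `|x + y| ^+ 2 = `|x| ^+ 2 + 2 * dot x y + `|y| ^+ 2.
Proof. by rewrite -!dotxx dotDl !dotDr (dotC y x); lra. Qed.

Lemma normB_sqr x y :
  `|x - y| ^+ 2 = `|x| ^+ 2 - 2 * dot x y + `|y| ^+ 2.
Proof. by rewrite -!dotxx dotBl !dotBr (dotC y x); lra. Qed.

Lemma parallelogram x y :
  `|x + y| ^+ 2 + `|x - y| ^+ 2 = 2 * `|x| ^+ 2 + 2 * `|y| ^+ 2.
Proof. by rewrite normD_sqr normB_sqr; lra. Qed.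

Lemma closure_normP Y x :
  (forall e, 0 < e -> exists2 y, Y y & `|x - y| < e) -> closure Y x.
Proof.
move=> Yx B /nbhs_ballP[e /= e0 xB]; have [y Yy xy] := Yx _ e0.
by exists y; split => //; apply: xB; rewrite -ball_normE.
Qed.

Lemma cauchy_norm_cvg (u : nat -> H) :
  (forall e : R, 0 < e -> exists N, forall m n,
    (N <= m)%N -> (N <= n)%N -> `|u m - u n| < e) ->
  exists l, forall e, 0 < e -> exists N, forall n, (N <= n)%N -> `|l - u n| < e.
Proof.
move=> cu.
have : cauchy (u @ \oo).
  apply: cauchy_exP => e e0; have [N uN] := cu _ e0.
  exists (u N); exists N => // n /= Nn.
  by rewrite -ball_normE /=; exact: uN.
move=> /cauchy_cvg /cvg_ex[/= l /cvgrPdist_lt ul].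
by exists l => e e0; have [N _ uN] := ul _ e0; exists N => n; exact: uN.
Qed.

(** A minimizing sequence for the distance from [x] to [Y] is Cauchy by the parallelogram law. Its
    limit attains the infimum, and at a minimizer the first variation of the squared distance
    vanishes. *)
Lemma orth_proj_exists Y x :
  Y 0 -> (forall a y z, Y y -> Y z -> Y (a *: y + z)) -> closed Y ->
  exists y, orth_proj Y x y.
Proof.
move=> Y0 Ylin Ycl.
pose E := [set `|x - y| ^+ 2 | y in Y]; pose D := inf E.
have Elb : has_lbound E by exists 0 => _ [y _ <-]; rewrite sqr_ge0.
have Einf : has_inf E by split => //; exists (`|x - 0| ^+ 2), 0.
have Dle y : Y y -> D <= `|x - y| ^+ 2.
  by move=> Yy; apply: ge_inf => //; exists y.
have harm_gt0 (n : nat) : 0 < n.+1%:R^-1 :> R by rewrite invr_gt0.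
have /choice[u uP] (n : nat) :
    exists y, Y y /\ `|x - y| ^+ 2 < D + n.+1%:R^-1.
  by have [_ [y Yy <-] yD] := inf_adherent (harm_gt0 n) Einf; exists y.
have dist_u m n : `|u m - u n| ^+ 2 <= 2 * m.+1%:R^-1 + 2 * n.+1%:R^-1.
  have [Ym um] := uP m; have [Yn un] := uP n.
  have := parallelogram (x - u n) (x - u m).
  rewrite (_ : x - u n - (x - u m) = u m - u n); last first.
    by rewrite opprB addrC subrKA.
  (* The midpoint stays in [Y], so its squared distance to [x] is at least [D]. *)
  have Ymid : Y (2^-1 *: (u m + u n)).
    rewrite -[X in Y X]addr0; apply: (Ylin) => //.
    by rewrite -[u m]scale1r; apply: Ylin.
  have := Dle _ Ymid.
  rewrite (_ : x - u n + (x - u m) = 2 *: (x - 2^-1 *: (u m + u n))).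
    rewrite normrZ ger0_norm // exprMn.
    by move: um un; move: (m.+1%:R^-1) (n.+1%:R^-1) => em en; lra.
  rewrite scalerBr scalerA divff // scale1r scaler_nat mulr2n.
  by rewrite opprD addrACA (addrC (- u n)).
have [l ul] : exists l, forall e, 0 < e ->
    exists N, forall n, (N <= n)%N -> `|l - u n| < e.
  apply: cauchy_norm_cvg => e e0.
  have [N Ne] := harm_lt (divr_gt0 (exprn_gt0 2 e0) (ltr0n R 4)).
  move: (Ne N (leqnn N)) => {}Ne.
  exists N => m n Nm Nn.
  rewrite -(ltr_pXn2r (n := 2)) ?nnegrE ?normr_ge0 ?(ltW e0) //.
  apply: le_lt_trans (dist_u m n) _.
  have le_harm i : (N <= i)%N -> i.+1%:R^-1 <= N.+1%:R^-1 :> R.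
    by move=> Ni; rewrite lef_pV2 ?posrE // ler_nat.
  move: (le_harm _ Nm) (le_harm _ Nn) Ne.
  by move: (m.+1%:R^-1) (n.+1%:R^-1) (N.+1%:R^-1) => em en eN; lra.
have Yl : Y l.
  apply: Ycl; apply: closure_normP => e e0; have [N uN] := ul _ e0.
  by exists (u N); [case: (uP N)|exact: uN].
exists l; split => // z Yz.
have lD : `|x - l| ^+ 2 <= D.
  apply/ler_addgt0Pr => e e0.
  have D0 : 0 <= D 
    by apply: lb_le_inf => //; [case: Einf|move=> _ [y _ <-]; rewrite sqr_ge0].
  (* The terms with [eta] in the square of [|x - u n| + eta] add up to at most [eta * (D + 3)],
     because [2 |x - u n| <= D + 2] and [eta <= 1]. *)
  pose eta := Num.min 1 (e / 2 / (D + 3)).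
  have eta0 : 0 < eta.
    by rewrite lt_min ltr01 !divr_gt0 // ltr_wpDl.
  have eta1 : eta <= 1 by rewrite ge_min lexx.
  have etae : eta * (D + 3) <= e / 2.
    by rewrite -ler_pdivlMr ?ltr_wpDl // ge_min lexx orbT.
  have [N1 lu] := ul _ eta0; have [N2 Ne] := harm_lt (divr_gt0 e0 (ltr0n R 2)).
  pose n := maxn N1 N2.
  have {}lu : `|l - u n| < eta by apply: lu; rewrite leq_maxl.
  have {}Ne : n.+1%:R^-1 < e / 2 by apply: Ne; rewrite leq_maxr.
  have [_ un] := uP n.
  have tri : `|x - l| <= `|x - u n| + eta.
    by rewrite (le_trans (ler_distD (u n) _ _)) // lerD2l distrC ltW.
  have sqr : `|x - l| ^+ 2 <= (`|x - u n| + eta) ^+ 2.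
    by rewrite lerXn2r ?nnegrE ?addr_ge0 // ltW.
  apply: (le_trans sqr).
  have : n.+1%:R^-1 <= 1 :> R by rewrite invf_le1 ?ltr0n // ler1n.
  move: un Ne; move: (n.+1%:R^-1) => en un ene en1.
  have := normr_ge0 (x - u n); nra.
have min a : 0 <= a ^+ 2 * `|z| ^+ 2 - 2 * a * dot (x - l) z.
  have := Dle (a *: z + l) (Ylin _ _ _ Yz Yl).
  rewrite (_ : x - _ = x - l - a *: z); last by rewrite opprD addrCA addrC.
  rewrite normB_sqr dotZr normrZ exprMn real_normK ?num_real //; lra.
have [->|z0] := eqVneq z 0; first exact: dot0r.
have zz : 0 < `|z| ^+ 2 by rewrite exprn_gt0 ?normr_gt0.
(* This coefficient minimizes the quadratic polynomial in [min]. *)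
have := min (dot (x - l) z / `|z| ^+ 2).
rewrite (_ : _ - _ = - (dot (x - l) z ^+ 2 / `|z| ^+ 2)); last first.
  by field; rewrite normr_eq0.
rewrite oppr_ge0 pmulr_lle0 ?invr_gt0 // => zle.
by apply/eqP; rewrite -sqrf_eq0 eq_le zle sqr_ge0.
Qed.

End HilbertSpace.

(** * Orthonormal families *)

Section Orthonormal.
Variables (R : realType) (H : hilbertSpace R).
Implicit Types (x y w : H) (Y : set H).

Lemma sqr_norm_sub_proj n (b : 'I_n -> H) x : orthonormal_family b ->
  `|x - \sum_i dot x (b i) *: b i| ^+ 2 = `|x| ^+ 2 - \sum_i dot x (b i) ^+ 2.
Proof.
move=> bb; rewrite normB_sqr -[X in _ + X]dotxx dot_suml dot_sumr.
have -> : \sum_i dot x (dot x (b i) *: b i) = \sum_i dot x (b i) ^+ 2.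
  by apply: eq_bigr => i _; rewrite dotZr expr2.
suff -> : \sum_i dot (dot x (b i) *: b i) (\sum_l dot x (b l) *: b l) =
    \sum_i dot x (b i) ^+ 2 by lra.
apply: eq_bigr => i _; rewrite dotZl dot_sumr expr2; congr (_ * _).
rewrite (bigD1 i)//= dotZr bb eqxx mulr1 big1 ?addr0// => l li.
by rewrite dotZr bb eq_sym (negbTE li) mulr0.
Qed.

Lemma orthonormal_norm n (b : 'I_n -> H) i : orthonormal_family b ->
  `|b i| ^+ 2 = 1.
Proof. by move=> bb; rewrite -dotxx bb eqxx. Qed.

(* The two sums are N and M minus the sum of all [dot (q i) (r l) ^+ 2]. *)
Lemma orthonormal_gap M N (q : 'I_M -> H) (r : 'I_N -> H) :
  orthonormal_family q -> orthonormal_family r -> (N <= M)%N ->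
  \sum_l `|r l - \sum_i dot (r l) (q i) *: q i| ^+ 2 <=
  \sum_i `|q i - \sum_l dot (q i) (r l) *: r l| ^+ 2.
Proof.
move=> qq rr NM.
under eq_bigr => l _ do rewrite sqr_norm_sub_proj// orthonormal_norm//.
under [leRHS]eq_bigr => i _ do rewrite sqr_norm_sub_proj// orthonormal_norm//.
rewrite !sumrB exchange_big/= !sumr_const !card_ord lerB ?ler_nat//.
by apply: ler_sum => i _; apply: ler_sum => l _; rewrite dotC.
Qed.

Lemma orthonormal_rcons n (b : 'I_n -> H) x : orthonormal_family b ->
  (forall i, dot x (b i) = 0) -> `|x| = 1 ->
  orthonormal_family (fun i : 'I_n.+1 => oapp b x (unlift ord_max i)).
Proof.
move=> bb xb x1 i l.
case: unliftP => [i' ->|->]; case: unliftP => [l' ->|->] /=.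
- by rewrite bb (inj_eq lift_inj).
- by rewrite dotC xb eq_sym (negbTE (neq_lift _ _)).
- by rewrite xb (negbTE (neq_lift _ _)).
- by rewrite dotxx x1 expr1n eqxx.
Qed.

(** Lengths are at most [M], so a longest family containing [w] exists; a nonzero vector orthogonal
    to it could be normalized and appended. With [w] as a member, a distance from [w] becomes one
    term of the sum in [orthonormal_gap]. *)
Lemma orthonormal_maximal Y M w :
  (forall a x, Y x -> Y (a *: x)) ->
  (forall N (r : 'I_N -> H), orthonormal_family r -> (forall i, Y (r i)) ->
    (N <= M)%N) ->
  Y w -> `|w| = 1 ->
  exists N (r : 'I_N -> H), [/\ orthonormal_family r, forall i, Y (r i),
    exists i, r i = w & forall x, Y x -> (forall i, dot x (r i) = 0) -> x = 0].
Proof.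
move=> YZ Ybound Yw w1.
pose P N := `[< exists r : 'I_N -> H, [/\ orthonormal_family r,
  forall i, Y (r i) & exists i, r i = w] >].
have exP : exists N, P N.
  exists 1%N; apply/asboolP; exists (fun=> w); split => //; last by exists ord0.
  by move=> i l; rewrite !ord1 dotxx w1 expr1n.
have leP N : P N -> (N <= M)%N by move/asboolP => [r [? ? _]]; exact: Ybound.
case: (ex_maxnP exP leP) => N /asboolP[r [rr Yr [i0 ri0]]] Nmax.
exists N, r; split => //; first by exists i0.
move=> x Yx xr; apply/eqP/negP => /negP x0.
suff /Nmax : P N.+1 by rewrite ltnn.
apply/asboolP; exists (fun i => oapp r (`|x|^-1 *: x) (unlift ord_max i)).
split.
- apply: orthonormal_rcons => //; first by move=> i; rewrite dotZl xr mulr0.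
  by rewrite normrZ normfV normr_id mulVf// normr_eq0.
- by move=> i; case: unlift => [i'|] /=; [exact: Yr|exact: YZ].
- by exists (lift ord_max i0); rewrite liftK.
Qed.

End Orthonormal.

(** * The Hodge decomposition of a Hilbert complex *)

Section HilbertComplex.
Variables (R : realType) (K : hilbertComplex R).
Implicit Types k : int.

Lemma VD k (u v : W K k) : V K k u -> V K k v -> V K k (u + v).
Proof. by move=> Vu Vv; rewrite -[u]scale1r; exact: V_lin. Qed.

Lemma VZ k a (u : W K k) : V K k u -> V K k (a *: u).
Proof. by move=> Vu; rewrite -[_ *: _]addr0; apply: V_lin => //; exact: V0. Qed.

Lemma VB k (u v : W K k) : V K k u -> V K k v -> V K k (u - v).
Proof. by move=> Vu Vv; rewrite -scaleN1r; apply: VD => //; exact: VZ. Qed.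

Lemma dD k (u v : W K k) : V K k u -> V K k v -> d K (u + v) = d K u + d K v.
Proof. by move=> Vu Vv; rewrite -[u in LHS]scale1r d_lin// scale1r. Qed.

Lemma d0 k : d K (0 : W K k) = 0.
Proof.
have := dD (V0 K k) (V0 K k); rewrite addr0 => /eqP.
by rewrite -{1}[d K 0]addr0 (inj_eq (addrI _)) => /eqP.
Qed.

Lemma dZ k a (u : W K k) : V K k u -> d K (a *: u) = a *: d K u.
Proof. by move=> Vu; rewrite -[a *: u]addr0 d_lin ?d0 ?addr0//; exact: V0. Qed.

Lemma dB k (u v : W K k) : V K k u -> V K k v -> d K (u - v) = d K u - d K v.
Proof.
by move=> Vu Vv; rewrite -scaleN1r dD ?dZ//; [rewrite scaleN1r|exact: VZ].
Qed.

Lemma normVE k (u : W K k) : normV u ^+ 2 = `|u| ^+ 2 + `|d K u| ^+ 2.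
Proof. by rewrite sqr_sqrtr /dotV !dotxx// addr_ge0 ?sqr_ge0. Qed.

Lemma normV_ge0 k (u : W K k) : 0 <= normV u.
Proof. exact: sqrtr_ge0. Qed.

Lemma norm_le_normV k (u : W K k) : `|u| <= normV u.
Proof.
rewrite -(ler_pXn2r (n := 2)) ?nnegrE ?normV_ge0// normVE.
by rewrite lerDl sqr_ge0.
Qed.

Lemma norm_d_le_normV k (u : W K k) : `|d K u| <= normV u.
Proof.
rewrite -(ler_pXn2r (n := 2)) ?nnegrE ?normV_ge0// normVE.
by rewrite lerDr sqr_ge0.
Qed.

Lemma normV_le k (u : W K k) : normV u <= `|u| + `|d K u|.
Proof.
rewrite -(ler_pXn2r (n := 2)) ?nnegrE ?normV_ge0 ?addr_ge0// normVE.
have := normr_ge0 u; have := normr_ge0 (d K u); nra.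
Qed.

Lemma normVZ k a (u : W K k) : V K k u -> normV (a *: u) = `|a| * normV u.
Proof.
move=> Vu; apply/eqP; rewrite -(eqrXn2 (n := 2)) ?mulr_ge0 ?normV_ge0//.
by rewrite exprMn !normVE dZ// !normrZ !exprMn mulrDr.
Qed.

Lemma normV_eq0 k (u : W K k) : normV u = 0 -> u = 0.
Proof.
move=> u0; apply/normr0_eq0/eqP.
by rewrite eq_le -{1}u0 norm_le_normV normr_ge0.
Qed.

Lemma normV0 k : normV (0 : W K k) = 0.
Proof. by rewrite -(scale0r 0) normVZ ?normr0 ?mul0r//; exact: V0. Qed.

Lemma normV_cocycle k (u : W K k) : d K u = 0 -> normV u = `|u|.
Proof.
move=> du; apply/eqP; rewrite -(eqrXn2 (n := 2)) ?normV_ge0// normVE du.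
by rewrite normr0 expr0n/= addr0.
Qed.

Lemma graph_closed k (u : W K k) (w : W K (k + 1)) :
  (forall e : R, 0 < e ->
    exists2 v, V K k v & `|u - v| < e /\ `|w - d K v| < e) ->
  V K k u /\ w = d K u.
Proof.
move=> uw; apply: (@d_closed _ K k (u, w)) => B /nbhs_ballP[e /= e0 uwB].
have [v Vv [uv wv]] := uw _ e0.
by exists (v, d K v); split => //; apply: uwB; split; rewrite -ball_normE.
Qed.

Lemma cocycle_closed k : closed (cocycles (V K) k).
Proof.
move=> u Zu; have [//|Vu du0] := @graph_closed _ u 0.
  move=> e e0; have [v [[Vv dv0] uv]] := Zu _ (nbhsx_ballx u e e0).
  exists v => //; rewrite dv0 subr0 normr0; split=> //.
  by move: uv; rewrite -ball_normE.
by split.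
Qed.

Lemma cocycle_lin k a (u v : W K k) : cocycles (V K) k u ->
  cocycles (V K) k v -> cocycles (V K) k (a *: u + v).
Proof.
move=> [Vu du] [Vv dv]; split; first exact: V_lin.
by rewrite d_lin// du dv scaler0 addr0.
Qed.

Lemma cocycle0 k : cocycles (V K) k 0.
Proof. by split; [exact: V0|exact: d0]. Qed.

Lemma cocycle_sum k n (a : 'I_n -> R) (b : 'I_n -> W K k) :
  (forall i, cocycles (V K) k (b i)) -> cocycles (V K) k (\sum_i a i *: b i).
Proof.
move=> Zb; apply: big_ind => [|x y Zx Zy|i _].
- exact: cocycle0.
- by rewrite -[x]scale1r; exact: cocycle_lin.
- by rewrite -[_ *: _]addr0; apply: cocycle_lin => //; exact: cocycle0.
Qed.

Lemma coboundary_cocycle k (u : W K k) : V K k u ->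
  cocycles (V K) (k + 1) (d K u).
Proof. by move=> Vu; split; [exact: d_dom|exact: dd0]. Qed.

Lemma cocycle_decomp k (u : W K k) : V K k u ->
  exists z, cocycles (V K) k z /\ cocycles_perp (V K) k (u - z).
Proof.
move=> Vu; have [z [Zz uz]] := @orth_proj_exists _ _ _ u
  (@cocycle0 k) (@cocycle_lin k) (@cocycle_closed k).
by exists z; split=> //; split=> //; apply: VB => //; case: Zz.
Qed.

Definition poincare k (c : R) :=
  forall v, cocycles_perp (V K) k v -> normV v <= c * `|d K v|.

(** Normalized counterexamples are orthogonal to all coboundaries, so the adjoint sends them to 0
    and they lie in a precompact set. Since d is closed, a cluster point is a cocycle; being also a
    limit of vectors orthogonal to cocycles, it is 0, against the unit norm. *)
Lemma poincareS (hK : compactness_property K) k :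
  exists c, poincare (k + 1) c.
Proof.
apply: contrapT => /forallNP noc.
have /choice[x xP] (n : nat) : exists x : W K (k + 1),
    [/\ cocycles_perp (V K) (k + 1) x, normV x = 1 & `|d K x| < n.+1%:R^-1].
  have /existsNP[v /not_implyP[[Vv vZ] /negP]] := noc n.+1%:R.
  rewrite -ltNge => nv.
  have v0 : 0 < normV v by apply: le_lt_trans nv; rewrite mulr_ge0.
  exists ((normV v)^-1 *: v); split.
  - by split=> [|z Zz]; [exact: VZ|rewrite dotZl vZ ?mulr0].
  - by rewrite normVZ// gtr0_norm ?invr_gt0// mulVf// gt_eqF.
  - rewrite dZ// normrZ gtr0_norm ?invr_gt0// mulrC ltr_pdivrMr//.
    by rewrite ltr_pdivlMl.
pose A := [set w | V K (k + 1) w /\ exists2 z, adjoint_graph w z &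
  `|w| ^+ 2 + `|d K w| ^+ 2 + `|z| ^+ 2 <= 1].
have xA n : A (x n).
  have [[Vx xZ] x1 _] := xP n; split=> //; exists 0.
    by move=> u Vu; rewrite dot0r dotC; apply: xZ; exact: coboundary_cocycle.
  by rewrite -normVE x1 normr0 expr1n expr0n/= addr0.
have [_ /(_ 1)] := hK k; rewrite -/A precompactE => cA.
have [|p [_ px]] := cA (x @ \oo) _.
  by exists 0%N => // n _; apply: subset_closure; exact: xA.
have near_p e (N : nat) : 0 < e -> exists2 n, (N <= n)%N & `|p - x n| < e.
  move=> e0; have [|_ [[n Nn <-] pn]] :=
      px (x @` [set n | (N <= n)%N]) (ball p e) _ (nbhsx_ballx p e e0).
    by exists N => // n Nn; exists n.
  by exists n => //; move: pn; rewrite -ball_normE.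
have near_0 e : 0 < e -> exists n, `|p - x n| < e /\ `|0 - d K (x n)| < e.
  move=> e0; have [N Ne] := harm_lt e0; have [n Nn pn] := near_p _ N e0.
  exists n; split=> //; rewrite sub0r normrN; have [_ _ xn] := xP n.
  exact: lt_trans xn (Ne _ Nn).
have [Vp dp] : V K (k + 1) p /\ 0 = d K p.
  apply: graph_closed => e /near_0[n pn]; exists (x n) => //.
  by have [[]] := xP n.
(* As [p] is a cocycle and [x n] is orthogonal to cocycles, [|p|^2 = <p - x n, p>]. *)
have p0 : p = 0.
  apply/eqP; rewrite -normr_le0; apply/ler_addgt0Pr => e e0; rewrite add0r.
  have [n [pn _]] := near_0 _ e0; have [[_ xZ] _ _] := xP n.
  have [->|p0] := eqVneq p 0; first by rewrite normr0 ltW.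
  rewrite -(ler_pM2l (x := `|p|)) ?normr_gt0// -expr2 -dotxx.
  rewrite -[X in dot X _](subrK (x n)) dotDl xZ ?addr0//.
  by rewrite (le_trans (dot_le _ _))// mulrC ler_wpM2l// ltW.
(* Two quarters bound [normV (x n)] by less than its value 1. *)
have [n []] := near_0 4^-1 ltac:(by []).
rewrite p0 !sub0r !normrN => xn dxn.
by have [_ xn1 _] := xP n; have := normV_le (x n); lra.
Qed.

(** Degrees are integers, so [k] is the successor of [k - 1]. *)
Lemma poincareP (hK : compactness_property K) k :
  exists c, poincare k c.
Proof. by have := poincareS hK (k - 1); rewrite subrK. Qed.

(** Approximate preimages of [w] are made orthogonal to the cocycles. The Poincaré inequality then
    makes them Cauchy because their images converge, and closedness of d shows that the limit is a
    preimage. *)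
Lemma coboundary_closed k c : poincare k c ->
  closed (coboundaries (V K) k).
Proof.
move=> Pc w Bw.
have /choice[x xP] (n : nat) : exists x : W K k,
    cocycles_perp (V K) k x /\ `|w - d K x| < n.+1%:R^-1.
  have [|_ [[y Vy <-]]] := Bw (ball w n.+1%:R^-1).
    by apply: nbhsx_ballx; rewrite invr_gt0.
  rewrite -ball_normE/= => wy; have [z [[Vz dz] yz]] := cocycle_decomp Vy.
  by exists (y - z); rewrite dB// dz subr0.
have Vx n : V K k (x n) by have [[]] := xP n.
(* [c] carries no sign, and a positive constant is needed to divide by. *)
have c'0 : 0 < Num.max c 1 by rewrite lt_max ltr01 orbT.
have [p px] : exists p, forall e : R, 0 < e ->
    exists N, forall n, (N <= n)%N -> `|p - x n| < e.
  apply: cauchy_norm_cvg => e e0.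
  have [N Ne] := harm_lt (divr_gt0 (divr_gt0 e0 (ltr0n R 2)) c'0).
  exists N => m n /Ne Nm /Ne Nn.
  have [[_ xmZ] wm] := xP m; have [[_ xnZ] wn] := xP n.
  have xmn : cocycles_perp (V K) k (x m - x n).
    by split=> [|z Zz]; [exact: VB|rewrite dotBl xmZ ?xnZ ?subrr].
  apply: le_lt_trans (norm_le_normV _) _; apply: le_lt_trans (Pc _ xmn) _.
  apply: (@le_lt_trans _ _ (Num.max c 1 * `|d K (x m - x n)|)).
    by rewrite ler_wpM2r// le_max lexx.
  rewrite mulrC -ltr_pdivlMr// dB//.
  rewrite (le_lt_trans (ler_distD w _ _))// distrC.
  have {wm Nm} := lt_trans wm Nm; have {wn Nn} := lt_trans wn Nn.
  by rewrite (mulrAC e); lra.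
suff [Vp ->] : V K k p /\ w = d K p by exists p.
apply: graph_closed => e e0; have [N1 N1P] := px _ e0.
have [N2 N2P] := harm_lt e0; exists (x (maxn N1 N2)) => //; split.
  by apply: N1P; rewrite leq_maxl.
have [_ wx] := xP (maxn N1 N2); apply: lt_trans wx _; apply: N2P.
by rewrite leq_maxr.
Qed.

Lemma coboundary_lin k a (u v : W K (k + 1)) : coboundaries (V K) k u ->
  coboundaries (V K) k v -> coboundaries (V K) k (a *: u + v).
Proof.
by move=> [x Vx <-] [y Vy <-]; exists (a *: x + y); [exact: V_lin|exact: d_lin].
Qed.

Lemma coboundary0 k : coboundaries (V K) k 0.
Proof. by exists 0; [exact: V0|exact: d0]. Qed.

(** Projection onto the closed range; subtracting a cocycle from the preimage keeps its image and
    makes the Poincaré bound available. *)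
Lemma coboundary_decomp k c : poincare k c -> forall w : W K (k + 1),
  exists x, [/\ V K k x, normV x <= c * `|d K x| &
    forall y, V K k y -> dot (w - d K x) (d K y) = 0].
Proof.
move=> Pc w; have [_ [[x Vx <-] wx]] := @orth_proj_exists _ _ _ w
  (@coboundary0 k) (@coboundary_lin k) (coboundary_closed Pc).
have [z [[Vz dz] xz]] := cocycle_decomp Vx.
have dxz : d K (x - z) = d K x by rewrite dB// dz subr0.
exists (x - z); split; first exact: VB.
  exact: Pc.
by move=> y Vy; rewrite dxz; apply: wx; exists y.
Qed.

Lemma hodge_decomp k c : poincare k c -> forall z : W K (k + 1),
  cocycles (V K) (k + 1) z ->
  exists x, [/\ V K k x, normV x <= c * `|d K x| &
    harmonics (V K) k (z - d K x)].
Proof.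
move=> Pc z [Vz dz]; have [x [Vx xc xz]] := coboundary_decomp Pc z.
exists x; split=> //; split; last by move=> _ [y Vy <-]; exact: xz.
split; first by apply: VB => //; exact: d_dom.
by rewrite dB ?dd0 ?dz ?subrr//; exact: d_dom.
Qed.

Lemma harmonic_dot_d k (w : W K (k + 1)) x : harmonics (V K) k w -> V K k x ->
  dot w (d K x) = 0.
Proof. by move=> [_ wB] Vx; apply: wB; exists x. Qed.

Lemma harmonicZ k a (w : W K (k + 1)) : harmonics (V K) k w ->
  harmonics (V K) k (a *: w).
Proof.
move=> [[Vw dw] wB]; split; first by split; [exact: VZ|rewrite dZ// dw scaler0].
by move=> x Bx; rewrite dotZl wB// mulr0.
Qed.

Lemma harmonicB k (v w : W K (k + 1)) : harmonics (V K) k v ->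
  harmonics (V K) k w -> harmonics (V K) k (v - w).
Proof.
move=> [[Vv dv] vB] [[Vw dw] wB]; split.
  by split; [exact: VB|rewrite dB// dv dw subrr].
by move=> x Bx; rewrite dotBl vB// wB// subrr.
Qed.

End HilbertComplex.

(** * Harmonic forms and the commuting operator *)

Section Defect.
Variables (R : realType) (K : hilbertComplex R).
Variables (S : subcomplex K) (Cpi : int -> R) (pih : forall k, W K k -> W K k).
Hypothesis pihP : bounded_cochain_operator S Cpi pih.

Lemma Vh_pih k x : V K k x -> Vh S k (pih x).
Proof. by have [+ _ _ _] := pihP k; apply. Qed.

Lemma V_pih k x : V K k x -> V K k (pih x).
Proof. by move/Vh_pih; exact: Vh_sub. Qed.

Lemma pih0 k : pih (0 : W K k) = 0.
Proof.
have [_ lin _ _] := pihP k; have := lin (-1) _ _ (V0 K k) (V0 K k).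
by rewrite scaler0 addr0 scaleN1r addNr.
Qed.

Lemma pihZ k a (x : W K k) : V K k x -> pih (a *: x) = a *: pih x.
Proof.
move=> Vx; have [_ lin _ _] := pihP k; have := lin a _ _ Vx (V0 K k).
by rewrite pih0 !addr0.
Qed.

Lemma V_sub_pih k (x : W K k) : V K k x -> V K k (x - pih x).
Proof. by move=> Vx; apply: VB => //; exact: V_pih. Qed.

Lemma d_sub_pihZ k a (x : W K k) : V K k x ->
  d K (a *: x - pih (a *: x)) = a *: d K (x - pih x).
Proof. by move=> Vx; rewrite pihZ// -scalerBr dZ//; exact: V_sub_pih. Qed.

(** Homogeneity reduces to the unit sphere, where V-boundedness of [pih] bounds the set from above,
    so that [sup] is a genuine upper bound. *)
Lemma dot_le_defect k (w : W K (k + 1)) x : V K k x ->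
  dot w (d K (x - pih x)) <= normV x * defect pih w.
Proof.
move=> Vx; have [x0|x0] := eqVneq (normV x) 0.
  by rewrite x0 mul0r (normV_eq0 x0) pih0 subr0 d0 dot0r.
have {}x0 : 0 < normV x by rewrite lt_neqAle eq_sym x0 normV_ge0.
rewrite -ler_pdivrMl// -dotZr -d_sub_pihZ//.
apply: ub_le_sup; last first.
  exists ((normV x)^-1 *: x) => //; split; first exact: VZ.
  by rewrite normVZ// gtr0_norm ?invr_gt0// mulVf// gt_eqF.
exists (`|w| * (1 + Cpi k)) => _ [y [Vy y1] <-].
apply: le_trans (dot_le _ _) _; rewrite ler_wpM2l// dB//; last exact: V_pih.
apply: le_trans (ler_normB _ _) _; apply: lerD.
  by rewrite -y1 norm_d_le_normV.
apply: le_trans (norm_d_le_normV _) _.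
by have [_ _ _ /(_ y Vy)] := pihP k; rewrite y1 mulr1.
Qed.

(** Opposite unit vectors give opposite values; without unit vectors the set is empty and its [sup]
    is 0. *)
Lemma defect_ge0 k (w : W K (k + 1)) : 0 <= defect pih w.
Proof.
have [[x [Vx x1]]|nounit] := pselect (exists x, V K k x /\ normV x = 1).
  have := dot_le_defect w Vx; have := dot_le_defect w (VZ (-1) Vx).
  by rewrite d_sub_pihZ// dotZr normVZ// normrN1 x1; lra.
rewrite /defect (_ : [set _ | _ in _] = set0) ?sup0//.
by apply/seteqP; split=> // t [x Vx _]; case: nounit; exists x.
Qed.

(** As [w] is orthogonal to [d (pih x)], [|d x|^2 = <w, d (x - pih x)>], which is at most [normV x]
    times the defect. The Poincaré bound on [x] then lets one factor [|d x|] cancel. *)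
Lemma coboundary_part_le k c (w : W K (k + 1)) x : 0 <= c -> V K k x ->
  normV x <= c * `|d K x| -> `|d K x| ^+ 2 = dot w (d K x) ->
  (forall y, Vh S k y -> dot w (d K y) = 0) -> `|d K x| <= c * defect pih w.
Proof.
move=> c0 Vx xc xw wh; have [->|dx0] := eqVneq `|d K x| 0.
  by rewrite mulr_ge0 ?defect_ge0.
have {}dx0 : 0 < `|d K x| by rewrite lt_neqAle eq_sym dx0 normr_ge0.
rewrite -(ler_pM2l dx0) -expr2 xw.
have -> : dot w (d K x) = dot w (d K (x - pih x)).
  by rewrite dB ?dotBr ?(wh _ (Vh_pih Vx)) ?subr0//; exact: V_pih.
apply: le_trans (dot_le_defect w Vx) _.
by rewrite mulrA (mulrC _ c) ler_wpM2r ?defect_ge0.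
Qed.

(** A unit [w] is placed in a maximal orthonormal harmonic family, so its squared distance to the
    span of [q] is one term of the first sum in [orthonormal_gap]. In the second sum, each [q i]
    minus its harmonic projection is a coboundary, which [coboundary_part_le] bounds by the defect
    of [q i]. *)
Lemma harmonic_gap k c Cmu M (q : 'I_M -> W K (k + 1)) (mu_ : 'I_M -> R) :
  0 <= c -> poincare K k c -> 0 <= Cmu ->
  orthonormal_family q -> harmonics (Vh S) k = span_of q ->
  (forall (N : nat) (r : 'I_N -> W K (k + 1)), orthonormal_family r ->
     (forall i, harmonics (V K) k (r i)) -> (N <= M)%N) ->
  (forall i, defect pih (q i) <= Cmu * mu_ i) ->
  forall w, harmonics (V K) k w -> exists2 wh, harmonics (Vh S) k wh &
    `|w - wh| <= c * Cmu * Num.sqrt (\sum_i mu_ i ^+ 2) * `|w|.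
Proof.
move=> c0 Pc Cmu0 qq hq dimH qmu.
have gap1 w : harmonics (V K) k w -> `|w| = 1 -> exists2 wh,
    harmonics (Vh S) k wh & `|w - wh| <= c * Cmu * Num.sqrt (\sum_i mu_ i ^+ 2).
  move=> Hw w1.
  have [N [r [rr Hr [l0 rl0] rmax]]] :=
    orthonormal_maximal (@harmonicZ _ _ k) dimH Hw w1.
  exists (\sum_i dot w (q i) *: q i).
    by rewrite hq; exists (fun i => dot w (q i)).
  have mu0 : 0 <= c * Cmu * Num.sqrt (\sum_i mu_ i ^+ 2).
    by rewrite !mulr_ge0// sqrtr_ge0.
  rewrite -(ler_pXn2r (n := 2)) ?nnegrE// exprMn sqr_sqrtr; last first.
    by apply: sumr_ge0 => i _; exact: sqr_ge0.
  have := orthonormal_gap qq rr (dimH _ _ rr Hr).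
  rewrite (bigD1 l0)//= rl0 => gap.
  apply: (le_trans (le_trans _ gap)).
    by rewrite lerDl; apply: sumr_ge0 => l _; exact: sqr_ge0.
  rewrite mulr_sumr; apply: ler_sum => i _; rewrite -exprMn.
  have hqi : harmonics (Vh S) k (q i).
    rewrite hq; exists (fun l => (l == i)%:R).
    rewrite (bigD1 i)//= eqxx scale1r big1 ?addr0// => l /negbTE ->.
    by rewrite scale0r.
  have [[Vhq dq] qB] := hqi.
  set y := q i - _.
  have Zy : cocycles (V K) (k + 1) y.
    rewrite /y [_ - _]addrC -scaleN1r; apply: cocycle_lin.
      by apply: cocycle_sum => l; have [] := Hr l.
    by split=> //; exact: (Vh_sub Vhq).
  have [x [Vx xc yx]] := hodge_decomp Pc Zy.
  (* [y - d x] is harmonic and orthogonal to every [r l], so it vanishes by maximality of the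
     family. *)
  have yE : y = d K x.
    apply/eqP; rewrite -subr_eq0; apply/eqP; apply: rmax => // l.
    rewrite dotBl (dotC (d K x)) harmonic_dot_d// subr0 dotBl dot_suml.
    rewrite (bigD1 l)//= dotZl rr eqxx mulr1 big1 ?addr0 ?subrr// => l' ll'.
    by rewrite dotZl rr (negbTE ll') mulr0.
  have yq : `|d K x| ^+ 2 = dot (q i) (d K x).
    rewrite -dotxx -{1}yE /y dotBl dot_suml big1 ?subr0// => l _.
    by rewrite dotZl harmonic_dot_d// mulr0.
  have qh z : Vh S k z -> dot (q i) (d K z) = 0.
    by move=> Vz; apply: qB; exists z.
  rewrite yE; have ydef := coboundary_part_le c0 Vx xc yq qh.
  have {}ydef : `|d K x| <= c * Cmu * mu_ i.
    by rewrite (le_trans ydef)// -mulrA ler_wpM2l.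
  by rewrite lerXn2r ?nnegrE// (le_trans _ ydef).
move=> w Hw; have [->|w0] := eqVneq w 0.
  exists 0; last by rewrite subrr normr0 mulr0.
  by rewrite hq; exists (fun=> 0); rewrite big1// => i _; rewrite scale0r.
have nw0 : 0 < `|w| by rewrite normr_gt0.
have [||wh hwh whw] := gap1 (`|w|^-1 *: w); first exact: harmonicZ.
  by rewrite normrZ normfV normr_id mulVf// normr_eq0.
exists (`|w| *: wh).
  move: hwh; rewrite hq => -[a ->]; exists (fun i => `|w| * a i).
  by rewrite scaler_sumr; apply: eq_bigr => i _; rewrite scalerA.
rewrite -[X in `|X - _|](scalerKV (lt0r_neq0 nw0)) -scalerBr normrZ normr_id.
by rewrite mulrC ler_wpM2r.
Qed.

End Defect.

(** * Residuals and the error bound *)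

Lemma le_of_sqr_le (R : realType) (x m : R) :
  0 <= m -> x ^+ 2 <= x * m -> x <= m.
Proof.
move=> m0 xm; have [//|mx] := leP x m.
have : x * m < x * x by rewrite ltr_pM2l// (le_lt_trans m0).
by rewrite -expr2; lra.
Qed.

(* In the application a, D, E, xB, xH, xP, pH and g are the norms of e_s, d e_s,
   d e_u, d rho, eta, w, p - theta and dx;
   al and be are the residuals at t and v. *)
Lemma error_arith (R : realType) (c a D E xB xH xP pH g al be : R) :
  1 <= c -> 0 <= a -> 0 <= D -> 0 <= xB -> 0 <= xH -> 0 <= g ->
  0 <= al -> 0 <= be ->
  D ^+ 2 <= D * be + D * g -> E ^+ 2 <= c * E * be -> xP <= c * E ->
  pH ^+ 2 <= pH * be -> xB ^+ 2 <= c * xB * al + a * (c * xB) ->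
  a ^+ 2 <= (a + D) * al + D * xB ->
  (a + D) + (xP + xB + xH + E) + (pH + g) <=
    10 * c ^+ 2 * (al + be + g + xH).
Proof.
move=> c1 a0 D0 xB0 xH0 g0 al0 be0 hD hE hxP hpH hxB ha.
have c0 : 0 <= c by lra.
have {}hD : D <= be + g by apply: le_of_sqr_le; [lra|rewrite mulrDr].
have {}hE : E <= c * be.
  by apply: le_of_sqr_le; [exact: mulr_ge0|rewrite mulrCA mulrA].
have {}hpH : pH <= be by exact: le_of_sqr_le.
have {}hxB : xB <= c * (al + a).
  apply: le_of_sqr_le; first by rewrite mulr_ge0 ?addr_ge0.
  by apply: le_trans hxB _; lra.
have {}ha : a <= 2 * (al + c * D).
  have cD0 : 0 <= c * D by exact: mulr_ge0.
  have DcD : D <= c * D by rewrite ler_peMl.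
  (* Inserting the bound on [xB] leaves a quadratic inequality for [a]. With [m = c * D] and
     [4 al m <= (al + m)^2] it forces [a <= 2 (al + m)]. *)
  have : a ^+ 2 <= a * (al + c * D) + 2 * (al * (c * D)).
    apply: le_trans ha _.
    have := ler_wpM2l D0 hxB; have := ler_wpM2l al0 DcD; lra.
  move: (c * D) cD0 => m m0 am.
  have : 4 * (al * m) <= (al + m) ^+ 2 by have := sqr_ge0 (al - m); nra.
  have [//|lt_a] := leP a (2 * (al + m)).
  nra.
have ccE : c * E <= c ^+ 2 * be by rewrite expr2 -mulrA ler_wpM2l.
have cD : c * D <= c * (be + g) by rewrite ler_wpM2l.
have ca : c * a <= 2 * (c * al) + 2 * (c ^+ 2 * (be + g)).
  have := ler_wpM2l c0 ha; have := ler_wpM2l c0 cD; rewrite !mulrA -!expr2; lra.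
(* The collected coefficients have degree at most two in [c], so [c >= 1] compares them all with
   [c ^+ 2]. *)
have le_c x : 0 <= x -> x <= c * x by move=> x0; rewrite ler_peMl.
have le_cc x : 0 <= x -> c * x <= c ^+ 2 * x.
  by move=> x0; rewrite expr2 -mulrA ler_wpM2l ?le_c.
have := le_c _ al0; have := le_c _ be0; have := le_c _ g0; have := le_c _ xH0.
have := le_cc _ al0; have := le_cc _ be0; have := le_cc _ g0.
have := le_cc _ xH0.
have := mulr_ge0 c0 al0; have := mulr_ge0 c0 be0; have := mulr_ge0 c0 g0.
lra.
Qed.

(** * Normalized test functions *)

Section TestFunctions.
Variables (R : realType) (K : hilbertComplex R) (k : int).

(** When [x] is 0, an arbitrary unit vector is taken; only the zero space has none, hence the
    condition [nontrivial]. *)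
Lemma normalized (x : W K k) : V K k x -> exists t,
  [/\ V K k t, nontrivial (V K k) -> normV t = 1 & x = normV x *: t].
Proof.
have unit y : V K k y -> y != 0 ->
    V K k ((normV y)^-1 *: y) /\ normV ((normV y)^-1 *: y) = 1.
  move=> Vy y0; split; first exact: VZ.
  have ny0 : normV y != 0 by apply: contra_neq y0; exact: normV_eq0.
  by rewrite normVZ// ger0_norm ?invr_ge0 ?normV_ge0// mulVf.
move=> Vx; have [->|x0] := eqVneq x 0.
  have [[y Vy y0]|triv] := pselect (nontrivial (V K k)).
    exists ((normV y)^-1 *: y); have [Vu u1] := unit _ Vy y0.
    by split=> //; rewrite normV0 scale0r.
  by exists 0; split=> //; [exact: V0|rewrite normV0 scale0r].
have [Vu u1] := unit _ Vx x0; exists ((normV x)^-1 *: x); split => //.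
by rewrite scalerKV//; apply: contra_neq x0; exact: normV_eq0.
Qed.

(** Among the normalized elements of the list, one with the largest [|F|] serves them all. This
    merges several test functions into the single one allowed in the error bound. *)
Lemma best_test (F : W K k -> R) (xs : seq (W K k)) :
  (forall a x, V K k x -> F (a *: x) = a * F x) ->
  (forall x, x \in xs -> V K k x) ->
  exists t, [/\ V K k t, nontrivial (V K k) -> normV t = 1 &
    forall x, x \in xs -> `|F x| <= normV x * `|F t|].
Proof.
move=> FZ; elim: xs => [_|x xs IH Vxs].
  by have [t [Vt t1 _]] := normalized (V0 K k); exists t.
have [|t [Vt t1 xst]] := IH.
  by move=> y ys; apply: Vxs; rewrite inE ys orbT.
have Vx : V K k x by apply: Vxs; rewrite inE eqxx.
have [t' [Vt' t'1 xt']] := normalized Vx.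
have Fx : `|F x| = normV x * `|F t'|.
  by rewrite {1}xt' FZ// normrM ger0_norm ?normV_ge0.
have [tt'|/ltW t't] := leP `|F t| `|F t'|; [exists t'|exists t]; split => // y.
  rewrite inE => /predU1P[->|/xst yt]; first by rewrite Fx.
  by rewrite (le_trans yt)// ler_wpM2l ?normV_ge0.
rewrite inE => /predU1P[->|]; last exact: xst.
by rewrite Fx ler_wpM2l ?normV_ge0.
Qed.

Lemma trivial_eq0 (x : W K k) : ~ nontrivial (V K k) -> V K k x -> x = 0.
Proof.
by move=> triv Vx; have [//|x0] := eqVneq x 0; case: triv; exists x.
Qed.

End TestFunctions.

(** Both vectors are divided by the sum of their norms, which lies between 1 and 2 unless both
    spaces are zero; this costs at most a factor 2. *)
Lemma normalize_pair (R : realType) (K : hilbertComplex R) (k l : int)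
    (F : W K k -> R) (G : W K l -> R) (t : W K k) (v : W K l) :
  (forall a x, V K k x -> F (a *: x) = a * F x) ->
  (forall a x, V K l x -> G (a *: x) = a * G x) ->
  V K k t -> V K l v ->
  (nontrivial (V K k) -> normV t = 1) -> (nontrivial (V K l) -> normV v = 1) ->
  exists t' v', [/\ V K k t', V K l v',
    nontrivial (V K k) \/ nontrivial (V K l) -> normV t' + normV v' = 1,
    `|F t| <= 2 * `|F t'| & `|G v| <= 2 * `|G v'|].
Proof.
move=> FZ GZ Vt Vv t1 v1; pose n := normV t + normV v.
have norm01 m (x : W K m) : V K m x -> (nontrivial (V K m) -> normV x = 1) ->
    normV x <= 1.
  move=> Vx x1; have [/x1 -> //|triv] := pselect (nontrivial (V K m)).
  by rewrite (trivial_eq0 triv Vx) normV0.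
have n2 : n <= 2.
  by have := norm01 _ _ Vt t1; have := norm01 _ _ Vv v1; rewrite /n; lra.
have tge := normV_ge0 t; have vge := normV_ge0 v.
have [ntr|triv] := pselect (nontrivial (V K k) \/ nontrivial (V K l));
    last first.
  exists t, v; split=> //.
    by have := normr_ge0 (F t); lra.
  by have := normr_ge0 (G v); lra.
have n1 : 1 <= n by case: ntr => [/t1|/v1]; rewrite /n => ->; lra.
have n0 : 0 < n by lra.
exists (n^-1 *: t), (n^-1 *: v); split; [exact: VZ|exact: VZ| | |].
- move=> _; rewrite !normVZ// gtr0_norm ?invr_gt0// -mulrDr mulVf// gt_eqF//.
- rewrite FZ// normrM gtr0_norm ?invr_gt0// mulrA ler_peMl//.
  by rewrite ler_pdivlMr// mul1r.
- rewrite GZ// normrM gtr0_norm ?invr_gt0// mulrA ler_peMl//.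
  by rewrite ler_pdivlMr// mul1r.
Qed.

(** * Galerkin orthogonality and the estimate up to the harmonic part of the error *)

Section ErrorBound.
Variables (R : realType) (K : hilbertComplex R).
Variables (S : subcomplex K) (Cpi : int -> R) (pih : forall k, W K k -> W K k).
Hypothesis pihP : bounded_cochain_operator S Cpi pih.
Variables (j : int) (f : W K (j + 1)).
Variables (s : W K j) (u p : W K (j + 1)) (sh : W K j) (uh ph : W K (j + 1)).
Hypothesis sol : hodge_laplace (V K) f s u p.
Hypothesis solh : hodge_laplace (Vh S) f sh uh ph.

Let es := s - sh.
Let eu := u - uh.
Let ep := p - ph.

Definition residual_s (t : W K j) : R :=
  dot es (t - pih t) - dot (d K (t - pih t)) eu.
Definition residual_u (v : W K (j + 1)) : R :=
  dot (f - d K sh - ph) (v - pih v) - dot (d K uh) (d K (v - pih v)).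
Definition residual_p (x : W K j) : R := dot ph (d K (x - pih x)).

(** [pih t] is an admissible test function in both problems, so its contributions cancel. *)
Lemma residual_sE t : V K j t -> residual_s t = dot es t - dot (d K t) eu.
Proof.
move=> Vt; have Vp := V_pih pihP Vt; have hp := Vh_pih pihP Vt.
have [_ s1 _ _] := sol; have [_ sh1 _ _] := solh.
have := s1 _ Vp; have := sh1 _ hp.
rewrite /residual_s dB// dotBr (dotBl (d K t)) /es /eu.
rewrite ?(dotBl s sh, dotBr _ u uh); lra.
Qed.

(** The discrete equation at [pih v] removes the terms in [pih v]; the continuous one at [v]
    eliminates [f]. *)
Lemma residual_uE v : V K (j + 1) v ->
  residual_u v = dot (d K es) v + dot (d K eu) (d K v) + dot v ep.
Proof.
move=> Vv; have Vp := V_pih pihP Vv; have hp := Vh_pih pihP Vv.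
have [[Vs Vu _] _ s2 _] := sol.
have [[/Vh_sub Vsh /Vh_sub Vuh _] _ sh2 _] := solh.
have := s2 _ Vv; have := s2 _ Vp; have := sh2 _ hp.
rewrite /residual_u (dotBr (f - _ - _)) !(dotBl (f - _), dotBl f).
rewrite dB// (dotBr (d K uh)) /es /eu /ep !dB// (dotBl (d K s)) (dotBl (d K u)).
rewrite (dotBr v p ph) !(dotC ph); lra.
Qed.

(** [d (pih x)] is a discrete coboundary, hence orthogonal to [ph]. *)
Lemma residual_pE x : V K j x -> residual_p x = dot ph (d K x).
Proof.
move=> Vx; have Vp := V_pih pihP Vx; have hp := Vh_pih pihP Vx.
have [[_ _ [_ phB]] _ _ _] := solh.
by rewrite /residual_p dB// dotBr (phB (d K (pih x))) ?subr0//; exists (pih x).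
Qed.

Lemma residual_sZ a t : V K j t -> residual_s (a *: t) = a * residual_s t.
Proof.
move=> Vt; rewrite !residual_sE ?dZ//; last exact: VZ.
by rewrite dotZr dotZl mulrBr.
Qed.

Lemma residual_uZ a v : V K (j + 1) v -> residual_u (a *: v) = a * residual_u v.
Proof.
move=> Vv; rewrite !residual_uE ?dZ//; last exact: VZ.
by rewrite !dotZr dotZl !mulrDr.
Qed.

Lemma residual_pZ a x : V K j x -> residual_p (a *: x) = a * residual_p x.
Proof.
move=> Vx; rewrite !residual_pE ?dZ//; last exact: VZ.
by rewrite dotZr.
Qed.

(** No residual sees the harmonic part [eta] of [eu], so it stays on the right-hand side; the
    identity for its norm is recorded for the later estimate by mu. *)
Lemma error_bound c : 1 <= c -> poincare K j c -> poincare K (j + 1) c ->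
  exists (eta : W K (j + 1)) (t : W K j) (v : W K (j + 1)) (x : W K j), [/\
    harmonics (V K) j eta, `|eta| ^+ 2 = - dot uh eta,
    [/\ V K j t, V K (j + 1) v & V K j x],
    [/\ nontrivial (V K j) -> normV t = 1,
        nontrivial (V K (j + 1)) -> normV v = 1 &
        nontrivial (V K j) -> normV x = 1] &
    normV es + normV eu + `|ep| <= 10 * c ^+ 2 *
      (`|residual_s t| + `|residual_u v| + c * `|residual_p x| + `|eta|)].
Proof.
move=> c1 Pj Pj1.
have [[Vs Vu Hp] _ _ uH] := sol.
have [[hsh huh [[hph dph] _]] _ _ _] := solh.
have [[Vsh Vuh] Vph] := (Vh_sub hsh, Vh_sub huh, Vh_sub hph).
have Ves : V K j es by exact: VB.
have Veu : V K (j + 1) eu by exact: VB.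
have Zph : cocycles (V K) (j + 1) ph by [].
have Zep : cocycles (V K) (j + 1) ep.
  rewrite /ep [_ - _]addrC -scaleN1r; apply: cocycle_lin => //; by case: Hp.
have Zdes : cocycles (V K) (j + 1) (d K es) by exact: coboundary_cocycle.
have [z [Zz wZ]] := cocycle_decomp Veu.
set w := eu - z in wZ; have [Vw wperp] := wZ.
have [rho [Vrho rhoc Heta]] := hodge_decomp Pj Zz.
set eta := z - d K rho in Heta.
have [x [Vx xc Htheta]] := hodge_decomp Pj Zph.
set theta := ph - d K x in Htheta.
(* The harmonic parts of [p] and [ph] combine, which splits [ep] into the harmonic [kappa] and the
   coboundary [- d x]. *)
pose kappa := p - theta.
have Hkappa : harmonics (V K) j kappa.
  exact: harmonicB.
have epE : ep = kappa - d K x by rewrite /kappa /theta opprB addrA addrAC addrK.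
have euE : eu = w + d K rho + eta.
  by rewrite /w /eta -addrA (addrCA (d K rho)) subrr addr0 subrK.
have [dw0 ddes0] : d K z = 0 /\ d K (d K es) = 0.
  by split; [case: Zz|case: Zdes].
have dwE : d K w = d K eu by rewrite /w dB ?dw0 ?subr0//; case: Zz.
have phE : ph = theta + d K x by rewrite subrK.
clearbody kappa theta eta w.
have [Zeta _] := Heta; have [[Vkappa dkappa] _] := Hkappa.
have weta : dot w eta = 0 by exact: wperp.
have rhoeta : dot eta (d K rho) = 0 by exact: harmonic_dot_d.
(* Coboundaries are orthogonal to [w] and to [eta]. *)
have euB y : V K j y -> dot (d K y) eu = dot (d K y) (d K rho).
  move=> Vy; rewrite euE !dotDr (dotC _ w) wperp; last first.
    exact: coboundary_cocycle.
  by rewrite (dotC _ eta) (harmonic_dot_d Heta)// addr0 add0r.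
have etaE : `|eta| ^+ 2 = - dot uh eta.
  have : dot eu eta = `|eta| ^+ 2.
    by rewrite euE !dotDl weta (dotC _ eta) rhoeta dotxx !add0r.
  by rewrite /eu dotBl uH// sub0r.
have phx : dot ph (d K x) = `|d K x| ^+ 2.
  by rewrite {1}phE dotDl harmonic_dot_d// add0r dotxx.
(* [d es] and [ep] are cocycles, hence orthogonal to [w], and [d w = d eu]. *)
have resw : residual_u w = `|d K eu| ^+ 2.
  rewrite residual_uE// dwE dotxx (dotC _ w) (wperp _ Zdes) (wperp _ Zep).
  by rewrite add0r addr0.
have reskappa : residual_u kappa = `|kappa| ^+ 2.
  rewrite residual_uE// dkappa dot0r (dotC _ kappa) harmonic_dot_d// epE dotBr.
  by rewrite harmonic_dot_d// dotxx subr0 !add0r.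
have resdes : residual_u (d K es) = `|d K es| ^+ 2 - dot (d K es) (d K x).
  rewrite residual_uE; last exact: d_dom.
  rewrite ddes0 dot0r addr0 dotxx epE dotBr.
  by rewrite (dotC _ kappa) harmonic_dot_d// sub0r.
have reses : residual_s es = `|es| ^+ 2 - dot (d K es) (d K rho).
  by rewrite residual_sE// dotxx euB.
have resrho : residual_s rho = dot es rho - `|d K rho| ^+ 2.
  by rewrite residual_sE// euB// dotxx.
have [|t [Vt t1 ts]] := best_test (xs := [:: es; rho]) residual_sZ.
  by move=> y; rewrite !inE => /orP[] /eqP->.
have [|v [Vv v1 vs]] := best_test (xs := [:: d K es; w; kappa]) residual_uZ.
  by move=> y; rewrite !inE => /or3P[] /eqP-> //; exact: d_dom.
have [|x' [Vx' x'1 xs]] := best_test (xs := [:: x]) residual_pZ.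
  by move=> y; rewrite inE => /eqP->.
exists eta, t, v, x'; split => //.
move: (ts es) (ts rho) (vs (d K es)) (vs w) (vs kappa) (xs x).
rewrite !inE !eqxx !orbT => /(_ isT) tes /(_ isT) trho /(_ isT) vdes.
move=> /(_ isT) vw /(_ isT) vkappa /(_ isT) xx.
have c0 : 0 <= c by lra.
(* The third residual at [x] is [|d x|^2]; the Poincaré bound on [normV x] supplies [c] and cancels
   one factor. *)
have gE : `|d K x| <= c * `|residual_p x'|.
  apply: le_of_sqr_le; first exact: mulr_ge0.
  rewrite -phx -residual_pE//; apply: le_trans (ler_norm _) _.
  by rewrite (le_trans xx)// mulrCA mulrA ler_wpM2r.
have total : normV es + normV eu + `|ep| <= (`|es| + `|d K es|) +
    (`|w| + `|d K rho| + `|eta| + `|d K eu|) + (`|kappa| + `|d K x|).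
  apply: lerD; [apply: lerD|].
  - exact: normV_le.
  - apply: le_trans (normV_le _) _; rewrite lerD2r {1}euE.
    by rewrite (le_trans (ler_normD _ _))// lerD2r ler_normD.
  - by rewrite epE ler_normB.
apply: le_trans total _.
apply: (@le_trans _ _ (10 * c ^+ 2 * (`|residual_s t| + `|residual_u v| +
    `|d K x| + `|eta|))); last first.
  by rewrite ler_wpM2l ?mulr_ge0 ?sqr_ge0// lerD2r lerD2l.
apply: error_arith => //.
- have -> : `|d K es| ^+ 2 = residual_u (d K es) + dot (d K es) (d K x).
    by rewrite resdes subrK.
  apply: lerD; last exact: dot_le.
  by rewrite (le_trans (ler_norm _))// (le_trans vdes)// normV_cocycle.
- rewrite -resw (le_trans (ler_norm _))// (le_trans vw)// ler_wpM2r//.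
  by rewrite -dwE; exact: Pj1.
- by rewrite -dwE (le_trans (norm_le_normV _))//; exact: Pj1.
- rewrite -reskappa (le_trans (ler_norm _))// (le_trans vkappa)//.
  by rewrite normV_cocycle.
- have -> : `|d K rho| ^+ 2 = - residual_s rho + dot es rho.
    by rewrite resrho opprB subrK.
  apply: lerD.
    rewrite (le_trans (ler_norm _))// normrN (le_trans trho)// ler_wpM2r//.
  rewrite (le_trans (dot_le _ _))// ler_wpM2l//.
  by rewrite (le_trans (norm_le_normV _)).
- have -> : `|es| ^+ 2 = residual_s es + dot (d K es) (d K rho).
    by rewrite reses subrK.
  apply: lerD; last exact: dot_le.
  by rewrite (le_trans (ler_norm _))// (le_trans tes)// ler_wpM2r// normV_le.
Qed.

End ErrorBound.

(** * The discrete solution and its component orthogonal to the discrete cocycles *)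

Section DiscreteHarmonicPart.
Variables (R : realType) (K : hilbertComplex R) (S : subcomplex K) (j : int).
Variables (uh b h uperp Puperp : W K (j + 1)).
Hypothesis uhE : uh = b + h + uperp.
Hypothesis bB : coboundaries (Vh S) j b.
Hypothesis hH : harmonics (Vh S) j h.
Hypothesis uperpZ : cocycles_perp (Vh S) (j + 1) uperp.
Hypothesis uhH : forall q, harmonics (Vh S) j q -> dot uh q = 0.
Hypothesis PuperpP : orth_proj (cocycles_perp (V K) (j + 1)) uperp Puperp.

(** Testing the third discrete equation with [h] itself gives [|h|^2 = 0]. *)
Lemma uhE0 : uh = b + uperp.
Proof.
suff h0 : h = 0 by rewrite uhE h0 addr0.
apply: dotxx_eq0; have := uhH hH; have [Zh Bh] := hH; have [_ uZ] := uperpZ.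
by rewrite uhE !dotDl (uZ _ Zh) (dotC b) (Bh _ bB) add0r addr0.
Qed.

Lemma uperp_le : `|uperp| <= `|uh|.
Proof.
have [y Vy dy] := bB; have [_ uZ] := uperpZ.
have bu : dot b uperp = 0.
  rewrite dotC; apply: uZ; rewrite -dy; split; first exact: Vh_d.
  by apply: dd0; exact: Vh_sub Vy.
rewrite -(ler_pXn2r (n := 2)) ?nnegrE// uhE0 normD_sqr bu mulr0 addr0.
by rewrite lerDr sqr_ge0.
Qed.

Lemma dot_uh_harmonic eta : harmonics (V K) j eta -> dot uh eta = dot uperp eta.
Proof.
move=> [_ eB]; have [y Vy dy] := bB; rewrite uhE0 dotDl (dotC b) eB ?add0r//.
by exists y => //; exact: Vh_sub Vy.
Qed.

(** The difference between [uperp - Puperp] and its cocycle part lies in [cocycles_perp]. It is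
    orthogonal to both of them and therefore zero. *)
Lemma sub_Puperp_cocycle : cocycles (V K) (j + 1) (uperp - Puperp).
Proof.
have [[VP PZ] uP] := PuperpP; have [Vu _] := uperpZ.
have [z [Zz xz]] := cocycle_decomp (VB (Vh_sub Vu) VP).
suff -> : uperp - Puperp = z by [].
have := uP _ xz; set x := uperp - Puperp in xz * => xxz.
have zxz : dot z (x - z) = 0 by case: xz => _ xz; rewrite dotC; exact: xz.
apply/eqP; rewrite -subr_eq0; apply/eqP/dotxx_eq0.
by rewrite dotBl xxz zxz subrr.
Qed.

Lemma sub_Puperp_le : `|uperp - Puperp| <= `|uperp|.
Proof.
have [ZP uP] := PuperpP.
rewrite -(ler_pXn2r (n := 2)) ?nnegrE// -[X in _ <= `|X| ^+ 2](subrK Puperp).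
by rewrite [leRHS]normD_sqr uP// mulr0 addr0 lerDl sqr_ge0.
Qed.

Lemma dot_sub_Puperp_cocycle z : cocycles (V K) (j + 1) z ->
  dot (uperp - Puperp) z = dot uperp z.
Proof. by have [[_ PZ] _] := PuperpP => Zz; rewrite dotBl PZ// subr0. Qed.

(** [uperp] is orthogonal to the discrete cocycle [etah], and [Puperp] to the cocycle [eta - etah].
    The product is thus [<uperp - Puperp, eta - etah>]. *)
Lemma dot_uperp_harmonic eta etah G : harmonics (V K) j eta ->
  harmonics (Vh S) j etah -> `|eta - etah| <= G * `|eta| ->
  `|dot uperp eta| <= `|uperp - Puperp| * (G * `|eta|).
Proof.
move=> [[Ve de] _] [[Veh deh] _] gap; have [_ uZ] := uperpZ.
have Vetah := Vh_sub Veh.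
have -> : dot uperp eta = dot (uperp - Puperp) (eta - etah).
  rewrite dot_sub_Puperp_cocycle; last first.
    by split; [exact: VB|rewrite dB// de deh subrr].
  by rewrite dotBr (uZ etah)// subr0.
by rewrite (le_trans (dot_abs_le _ _))// ler_wpM2l.
Qed.

End DiscreteHarmonicPart.

(* The degree of the problem is k = j + 1. *)
Theorem lemma3 (R : realType) (K : hilbertComplex R)
    (hK : compactness_property K) (j : int)
    (Cpi : int -> R) (Cmu Ceps : R) (hCmu : 0 < Cmu) (hCeps : 0 < Ceps) :
  exists2 C : R, 0 < C &
  forall (S : subcomplex K) (pih : forall k, W K k -> W K k)
    (f : W K (j + 1))
    (s : W K j) (u p : W K (j + 1)) (sh : W K j) (uh ph : W K (j + 1))
    (M : nat) (q : 'I_M -> W K (j + 1)) (mu_ : 'I_M -> R)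
    (b h uperp Puperp : W K (j + 1)),
  bounded_cochain_operator S Cpi pih ->
  hodge_laplace (V K) f s u p ->
  hodge_laplace (Vh S) f sh uh ph ->
  (* q is an orthonormal basis of the discrete harmonic space *)
  orthonormal_family q ->
  harmonics (Vh S) j = span_of q ->
  (* dim of the harmonic space <= dim of the discrete harmonic space *)
  (forall (N : nat) (r : 'I_N -> W K (j + 1)), orthonormal_family r ->
     (forall i, harmonics (V K) j (r i)) -> (N <= M)%N) ->
  (forall i, defect pih (q i) <= Cmu * mu_ i) ->
  (* uperp is the last component of the discrete Hodge decomposition of uh *)
  uh = b + h + uperp -> coboundaries (Vh S) j b -> harmonics (Vh S) j h ->
  cocycles_perp (Vh S) (j + 1) uperp ->
  orth_proj (cocycles_perp (V K) (j + 1)) uperp Puperp ->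
  let mu := Num.sqrt (\sum_i mu_ i ^+ 2) in
  let es := s - sh in let eu := u - uh in let ep := p - ph in
  [/\ exists (t : W K j) (v r : W K (j + 1)) (phi : W K j),
        [/\ [/\ V K j t, V K (j + 1) v, harmonics (V K) j r & V K j phi],
            nontrivial (V K j) \/ nontrivial (V K (j + 1)) ->
              normV t + normV v + `|r| = 1,
            nontrivial (V K j) -> normV phi = 1
          & normV es + normV eu + `|ep| <=
            C * (`|dot es (t - pih j t) - dot (d K (t - pih j t)) eu|
               + `|dot (f - d K sh - ph) (v - pih (j + 1) v)
                   - dot (d K uh) (d K (v - pih (j + 1) v))|
               + `|dot ph (d K (phi - pih j phi))|
               + mu * `|uperp - Puperp|)],
      `|uperp - Puperp| <= `|uh|
    & forall eps : R, defect pih uperp <= Ceps * eps ->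
        mu * `|uperp - Puperp| <= C * (mu * eps + mu ^+ 2 * `|uh|)].
Proof.
(* One Poincaré constant, at least 1, serves both degrees. *)
have [c [c1 Pj Pj1]] :
    exists c, [/\ 1 <= c, poincare K j c & poincare K (j + 1) c].
  have [c1 P1] := poincareP hK j; have [c2 P2] := poincareP hK (j + 1).
  exists (Num.max 1 (Num.max c1 c2)); split; first by rewrite le_max lexx.
  - by move=> x /P1/le_trans; apply; rewrite ler_wpM2r// !le_max lexx orbT.
  - by move=> x /P2/le_trans; apply; rewrite ler_wpM2r// !le_max lexx !orbT.
have c0 : 0 <= c by lra.
(* [C1] is the factor of [error_bound]. In [C2], the 2 comes from [normalize_pair], [c] from the
   weight of the third residual and [c * Cmu] from the estimate of [eta]. *)
pose C1 := 10 * c ^+ 2; pose C2 := 2 + c + c * Cmu.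
have cCmu : 0 <= c * Cmu by rewrite mulr_ge0// ltW.
have cCeps : 0 <= c * Ceps by rewrite mulr_ge0// ltW.
have C10 : 0 < C1 by rewrite mulr_gt0// exprn_gt0//; lra.
have C120 : 0 < C1 * C2 by rewrite mulr_gt0// /C2; lra.
(* The two added terms are the coefficients in the refined bound of the last claim. *)
exists (C1 * C2 + c * Ceps + c * Cmu); first by lra.
move=> S pih f s u p sh uh ph M q mu_ b h uperp Puperp pihP sol solh qq hq dimH
  qmu uhE bB hH uperpZ PuperpP mu es eu ep.
have [_ _ _ uhH] := solh.
have mu0 : 0 <= mu by exact: sqrtr_ge0.
set X := uperp - Puperp.
have gap eta : harmonics (V K) j eta ->
    `|dot uperp eta| <= `|X| * (c * Cmu * mu * `|eta|).
  move=> He.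
  have [etah Heh le_gap] :=
    harmonic_gap pihP c0 Pj (ltW hCmu) qq hq dimH qmu He.
  exact: (dot_uperp_harmonic uperpZ PuperpP He Heh le_gap).
have Xle : `|X| <= `|uperp| by exact: sub_Puperp_le PuperpP.
have ule : `|uperp| <= `|uh| := uperp_le uhE bB hH uperpZ uhH.
have ZX : cocycles (V K) (j + 1) X := sub_Puperp_cocycle uperpZ PuperpP.
have dotX z : cocycles (V K) (j + 1) z -> dot X z = dot uperp z.
  exact: dot_sub_Puperp_cocycle.
clearbody X; split; last 2 first.
- exact: le_trans Xle ule.
- move=> eps ueps.
  have eps0 : 0 <= eps.
    by rewrite -(pmulr_rge0 _ hCeps) (le_trans _ ueps)// (defect_ge0 pihP).
  (* The cocycle [X] splits into a coboundary, controlled by the defect of [uperp], and a harmonic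
     part, controlled by [gap]. *)
  have [x [Vx xc Heta]] := hodge_decomp Pj ZX.
  have XE : X = (X - d K x) + d K x by rewrite subrK.
  have Xx : `|d K x| ^+ 2 = dot uperp (d K x).
    rewrite -dotX; last exact: coboundary_cocycle.
    by rewrite {1}XE dotDl (harmonic_dot_d Heta)// add0r dotxx.
  have dx : `|d K x| <= c * Ceps * eps.
    rewrite -mulrA; apply: le_trans (ler_wpM2l c0 ueps).
    apply: (coboundary_part_le pihP) => // y Vy; case: uperpZ => _; apply.
    by split; [exact: Vh_d|apply: dd0; exact: Vh_sub Vy].
  have eta_le : `|X - d K x| <= c * Cmu * mu * `|uh|.
    apply: le_of_sqr_le; first by rewrite !mulr_ge0// ltW.
    have -> : `|X - d K x| ^+ 2 = dot uperp (X - d K x).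
      rewrite -dotX; last by case: Heta.
      rewrite [X in dot X _]XE dotDl (dotC (d K x)) (harmonic_dot_d Heta)//.
      by rewrite addr0 dotxx.
    rewrite (le_trans (ler_norm _))// (le_trans (gap _ Heta))//.
    rewrite (_ : `|X| * _ = `|X - d K x| * (c * Cmu * mu) * `|X|); last by ring.
    rewrite -mulrA ler_wpM2l// ler_wpM2l ?(le_trans Xle)//.
    by rewrite !mulr_ge0// ltW.
  have Xb : `|X| <= c * Ceps * eps + c * Cmu * mu * `|uh|.
    by rewrite [leRHS]addrC XE (le_trans (ler_normD _ _))// lerD.
  apply: le_trans (ler_wpM2l mu0 Xb) _.
  have := mulr_ge0 mu0 eps0; have := mulr_ge0 (sqr_ge0 mu) (normr_ge0 uh).
  set m1 := mu ^+ 2 * _; set m2 := mu * eps => m10 m20.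
  have -> : mu * (c * Ceps * eps + c * Cmu * mu * `|uh|) =
    c * Ceps * m2 + c * Cmu * m1 by rewrite /m1 /m2; ring.
  have := mulr_ge0 (ltW C120) m10; have := mulr_ge0 (ltW C120) m20.
  have := mulr_ge0 cCmu m20; have := mulr_ge0 cCeps m10; lra.
have [eta [t [v [x [Heta etaE [Vt Vv Vx] [t1 v1 x1] bound]]]]] :=
  error_bound pihP sol solh c1 Pj Pj1.
have [t' [v' [Vt' Vv' tv1 tt' vv']]] := normalize_pair
  (residual_sZ pihP sol solh) (residual_uZ pihP sol solh) Vt Vv t1 v1.
(* The normalization is carried by [t'] and [v'] alone, so the harmonic test form is 0. *)
exists t', v', 0, x; split => //.
- split => //; split; last by move=> y _; rewrite dot0l.
  exact: cocycle0.
- by move=> /tv1; rewrite normr0 addr0.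
apply: le_trans bound _.
(* The coboundary part of [uh] is orthogonal to harmonic forms, so [|eta|^2 = - <uperp, eta>] and
   [gap] applies. *)
have eta_le : `|eta| <= c * Cmu * (mu * `|X|).
  apply: le_of_sqr_le; first by rewrite !mulr_ge0// ltW.
  rewrite etaE (dot_uh_harmonic uhE bB hH uperpZ uhH Heta).
  rewrite (le_trans (ler_norm _))// normrN (le_trans (gap _ Heta))//.
  by rewrite le_eqVlt; apply/orP; left; apply/eqP; ring.
have rs := normr_ge0 (residual_s pih s u sh uh t').
have ru := normr_ge0 (residual_u pih f sh uh ph v').
have rp := normr_ge0 (residual_p pih ph x).
have mX : 0 <= mu * `|X| by rewrite mulr_ge0.
apply: (@le_trans _ _ (C1 * C2 * (`|residual_s pih s u sh uh t'| +
    `|residual_u pih f sh uh ph v'| + `|residual_p pih ph x| + mu * `|X|)));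
  last first.
  by rewrite ler_wpM2r ?addr_ge0//; lra.
rewrite -(mulrA C1); apply: ler_wpM2l; first exact: ltW.
move: tt' vv' eta_le rs ru rp mX; rewrite /C2.
move: (`|residual_s _ _ _ _ _ t'|) (`|residual_u _ _ _ _ _ v'|).
move: (`|residual_p _ _ _|) (mu * `|X|) => rp m rs ru tt' vv' eta_le.
move=> rs0 ru0 rp0 m0.
have := mulr_ge0 c0 rs0; have := mulr_ge0 c0 ru0; have := mulr_ge0 c0 m0.
have := mulr_ge0 cCmu rs0; have := mulr_ge0 cCmu ru0; have := mulr_ge0 cCmu rp0.
lra.
Qed.
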